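(* Let $(a,b,c,d,e,f)$ be any one of the following fifteen 6-tuples: $(1,-1,1,-1,-2,1)$, $(1,-1,1,-2,-1,1)$, $(1,1,-1,-2,1,1)$, $(1,1,2,-2,3,1)$, $(1,-1,3,2,-2,1)$, $(1,-1,3,-2,2,1)$, $(2,-1,-1,1,-6,1)$, $(2,-1,-1,-6,1,1)$, $(1,1,1,-6,-1,2)$, $(2,1,2,-2,5,1)$, $(1,-1,5,-2,2,2)$, $(1,-2,5,2,-2,1)$, $(1,-1,7,-7,2,4)$, $(1,-4,7,2,-7,1)$, $(1,4,-7,2,7,1)$. Then for every positive integer $n$ and all integers $m$ and $p$, \[ \sum_{j = 0}^{\lfloor n/2 \rfloor} ( - 1)^j \frac{n}{n - j}\binom{n-j}{j}a^j b^j f^{n - 2j} P_{(m + e)n + p + (c - 2e + d)j} = a^n P_{(m + c)n + p} + b^n P_{(m + d)n + p} \] and \[ \sum_{j = 0}^{\lfloor n/2 \rfloor} ( - 1)^j \frac{n}{n - j}\binom{n-j}{j}a^j b^j f^{n - 2j} Q_{(m + e)n + p + (c - 2e + d)j} = a^n Q_{(m + c)n + p} + b^n Q_{(m + d)n + p}. \]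
   Context: The Padovan numbers $P_n$ are defined for all integers $n$ by $P_0=P_1=P_2=1$ and $P_n=P_{n-2}+P_{n-3}$ for all integers $n$ (extended to negative indices via $P_n=P_{n+3}-P_{n+1}$). The Perrin numbers $Q_n$ are defined for all integers $n$ by $Q_0=3$, $Q_1=0$, $Q_2=2$ and $Q_n=Q_{n-2}+Q_{n-3}$ for all integers $n$. *)

(* Defs.v *)
From HB Require Import structures.
From mathcomp Require Import all_boot all_order all_algebra.
From mathcomp Require Import ring zify.
Set Implicit Arguments.
Unset Strict Implicit.
Unset Printing Implicit Defensive.
Import Order.TTheory GRing.Theory Num.Theory.
Local Open Scope ring_scope.

(* The state (x, y, z) holds three consecutive values u_n, u_(n+1), u_(n+2) of
   a sequence with u_(n+3) = u_(n+1) + u_n. *)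
Definition pad_next (s : int * int * int) : int * int * int :=
  let: (x, y, z) := s in (y, z, x + y).

Definition pad_prev (s : int * int * int) : int * int * int :=
  let: (x, y, z) := s in (z - x, x, y).

Definition pad_state (s : int * int * int) (n : int) : int * int * int :=
  match n with
  | Posz k => iter k pad_next s
  | Negz k => iter k.+1 pad_prev s
  end.

Definition padovan (n : int) : int := (pad_state (1, 1, 1) n).1.1.

Definition perrin (n : int) : int := (pad_state (3, 0, 2) n).1.1.

Lemma pad_prevK : cancel pad_prev pad_next.
Proof. by move=> [[x y] z] /=; rewrite subrK. Qed.

Lemma pad_stateS s n : pad_state s (n + 1) = pad_next (pad_state s n).
Proof.
case: n => [k|[|k]]; last 2 first.
- by rewrite /= pad_prevK.
- have -> : Negz k.+1 + 1 = Negz k by lia.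
  by rewrite [pad_state s (Negz k.+1)]/= pad_prevK.
by have -> : Posz k + 1 = Posz k.+1 by lia.
Qed.

Lemma pad_state_rec s n :
  (pad_state s n).1.1 = (pad_state s (n - 2)).1.1 + (pad_state s (n - 3)).1.1.
Proof.
have E1 : n - 2 = (n - 3) + 1 by ring.
have E2 : n = (n - 3) + 1 + 1 + 1 by ring.
rewrite {1}E2 E1 !pad_stateS.
by case: (pad_state s (n - 3)) => [[x y] z] /=; rewrite addrC.
Qed.

Lemma padovan_init : [/\ padovan 0 = 1, padovan 1 = 1 & padovan 2 = 1].
Proof. by []. Qed.

Lemma padovan_rec n : padovan n = padovan (n - 2) + padovan (n - 3).
Proof. exact: pad_state_rec. Qed.

Lemma perrin_init : [/\ perrin 0 = 3, perrin 1 = 0 & perrin 2 = 2].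
Proof. by []. Qed.

Lemma perrin_rec n : perrin n = perrin (n - 2) + perrin (n - 3).
Proof. exact: pad_state_rec. Qed.

(* The coefficients (a, b, c, d, e, f), each of which satisfies
   a r^c + b r^d = f r^e for every root r of X^3 - X - 1. *)
Definition pad_tuples : seq (int * int * int * int * int * int) :=
  [:: (1, -1, 1, -1, -2, 1);
      (1, -1, 1, -2, -1, 1);
      (1, 1, -1, -2, 1, 1);
      (1, 1, 2, -2, 3, 1);
      (1, -1, 3, 2, -2, 1);
      (1, -1, 3, -2, 2, 1);
      (2, -1, -1, 1, -6, 1);
      (2, -1, -1, -6, 1, 1);
      (1, 1, 1, -6, -1, 2);
      (2, 1, 2, -2, 5, 1);
      (1, -1, 5, -2, 2, 2);
      (1, -2, 5, 2, -2, 1);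
      (1, -1, 7, -7, 2, 4);
      (1, -4, 7, 2, -7, 1);
      (1, 4, -7, 2, 7, 1)].

(* Main.v *)
(** If [u] satisfies [a u(k+c) + b u(k+d) = f u(k+e)] for all [k], then
    [L_n(k) = a^n u(k+cn) + b^n u(k+dn)] satisfies
    [L_(n+2)(k) = f L_(n+1)(k+e) - a b L_n(k+c+d)].  Unfolding this recurrence down
    to [L_1(k) = f u(k+e)] and [L_0(k) = 2 u(k)] produces the coefficients
    [n/(n-j) 'C(n-j,j)] of the Lucas polynomials.  The relation between three terms
    holds for each tuple because the state at [k+i] is a fixed linear function,
    computable for each numeral [i], of the state at [k]. *)
Require Import Defs.
From mathcomp Require Import all_boot all_order all_algebra.
From mathcomp Require Import ring zify.
Set Implicit Arguments.
Unset Strict Implicit.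
Unset Printing Implicit Defensive.
Import Order.TTheory GRing.Theory Num.Theory.
Local Open Scope ring_scope.

Lemma pad_nextK : cancel pad_next pad_prev.
Proof. by move=> [[x y] z] /=; rewrite addrK. Qed.

Lemma pad_stateB1 s k : pad_state s (k - 1) = pad_prev (pad_state s k).
Proof. by rewrite -[k in RHS](subrK 1) pad_stateS pad_nextK. Qed.

Lemma pad_stateD s k i : pad_state s (k + i) = pad_state (pad_state s k) i.
Proof.
elim: i => [|i IH|i IH]; first by rewrite addr0.
  by rewrite intS [1 + _]addrC addrA !pad_stateS IH.
by rewrite intS opprD [- 1 - _]addrC addrA !pad_stateB1 IH.
Qed.

Lemma pad_tuples_relation (s : int * int * int) (a b c d e f k : int) :
  (a, b, c, d, e, f) \in pad_tuples ->
  a * (pad_state s (k + c)).1.1 + b * (pad_state s (k + d)).1.1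
    = f * (pad_state s (k + e)).1.1.
Proof.
rewrite !pad_stateD; case: (pad_state s k) => [[x y] z]; rewrite /pad_tuples.
do 15! [rewrite in_cons; case/orP=> [/eqP[-> -> -> -> -> ->] | ];
         first by rewrite /=; ring].
by [].
Qed.

(* The coefficient, up to sign, of [x^(n-2j) y^j] in the Lucas polynomial given by
   [L_0 = 2], [L_1 = x], [L_(n+2) = x L_(n+1) - y L_n]. *)
Fixpoint lucas_coef (n j : nat) : nat :=
  match n with
  | 0 => if j is 0 then 2 else 0
  | n1.+1 =>
    if j isn't j'.+1 then 1
    else if n1 is n'.+1 then lucas_coef n1 j + lucas_coef n' j' else 0
  end.

Lemma lucas_coefSS n j :
  lucas_coef n.+2 j.+1 = (lucas_coef n.+1 j.+1 + lucas_coef n j)%N.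
Proof. by []. Qed.

(** This allows sums over [j] to run past [n/2], and covers the cases where [n - 2 * j] is
    truncated. *)
Lemma lucas_coef_small n j : (n < j.*2)%N -> lucas_coef n j = 0%N.
Proof.
elim/ltn_ind: n j => -[|[|n]] IH [|j] //.
by rewrite doubleS !ltnS => ltnj; rewrite lucas_coefSS !IH // doubleS; lia.
Qed.

(* Indexing by [i = n - 2j] turns the recurrence into Pascal's rule. *)
Lemma lucas_coef_bin i j :
  lucas_coef (i + j.+1.*2) j.+1 = ('C(i + j.+1, j.+1) + 'C(i + j, j))%N.
Proof.
elim: i j => [|i IHi] j.
  (* On the diagonal [n = 2j] the recurrence keeps only its second term, so the value 2 of
     [lucas_coef 0 0] propagates. *)
  rewrite !add0n !binn; elim: j => [//|j IHj].
  by rewrite doubleS lucas_coefSS IHj lucas_coef_small.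
elim: j => [|j IHj].
  rewrite (_ : i.+1 + 1.*2 = i.+1.+2)%N; last lia.
  move: (IHi 0); rewrite (_ : i + 1.*2 = i.+2)%N; last lia.
  rewrite (lucas_coefSS i.+1) => ->; rewrite !bin1 !bin0.
  by rewrite /=; lia.
rewrite (_ : i.+1 + j.+2.*2 = (i.+1 + j.+1.*2).+2)%N; last lia.
rewrite lucas_coefSS IHj (_ : (i.+1 + j.+1.*2).+1 = i + j.+2.*2)%N; last lia.
have := binS (i + j.+1) j; rewrite IHi (binS (i + j.+2)) -addnS !addSnnS; lia.
Qed.

(** For [j + 1] and [i = n - 2(j + 1)], absorption gives [(i+j+1) 'C(i+j, j) = (j+1) 'C(i+j+1,
    j+1)], and [(i+j+1) + (j+1) = n]. *)
Lemma mul_lucas_coef n j : (0 < n)%N -> (j.*2 <= n)%N ->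
  ((n - j) * lucas_coef n j = n * 'C(n - j, j))%N.
Proof.
case: j => [|j] n_gt0 lejn; first by case: n n_gt0 lejn => // n; rewrite bin0 subn0.
rewrite -(subnK lejn); set i := (n - _)%N; rewrite lucas_coef_bin.
have -> : (i + j.+1.*2 - j.+1 = i + j.+1)%N by lia.
have := mul_bin_diag (i + j.+1) j; rewrite addnS /=; nia.
Qed.

Lemma lucas_coefE (F : numFieldType) n j : (0 < n)%N -> (j.*2 <= n)%N ->
  (lucas_coef n j)%:R = n%:R / (n - j)%N%:R * 'C(n - j, j)%:R :> F.
Proof.
move=> n_gt0 lejn; have nz : (n - j)%N%:R != 0 :> F by rewrite pnatr_eq0; lia.
by apply: (mulfI nz); rewrite -natrM mul_lucas_coef // mulrA mulrCA mulfV // mulr1 natrM.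
Qed.

Section LucasSum.

Variables (R : comNzRingType) (u : int -> R) (a b f : R) (c d e : int).
Hypothesis rel_u : forall k, a * u (k + c) + b * u (k + d) = f * u (k + e).

(** Each factor [f] shifts the index by [e] and each factor [a * b] by [c + d]: the total is
    [e(n-2j) + (c+d)j]. *)
Let term n k j : R :=
  (-1) ^+ j * (lucas_coef n j)%:R * a ^+ j * b ^+ j * f ^+ (n - 2 * j)
  * u (k + e * n%:Z + (c - 2 * e + d) * j%:Z).

Let rhs n k : R := a ^+ n * u (k + c * n%:Z) + b ^+ n * u (k + d * n%:Z).

Let term_small n k j : (n < j.*2)%N -> term n k j = 0.
Proof. by move=> lt_nj; rewrite /term lucas_coef_small // mulr0 !mul0r. Qed.

Let termS0 n k : term n.+2 k 0 = f * term n.+1 (k + e) 0.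
Proof.
rewrite /term !muln0 !subn0 [f ^+ n.+2]exprS.
have -> : k + e + e * n.+1%:Z = k + e * n.+2%:Z by rewrite !intS; ring.
by rewrite /=; ring.
Qed.

Let termSS n k j :
  term n.+2 k j.+1 = f * term n.+1 (k + e) j.+1 - a * b * term n (k + c + d) j.
Proof.
have E1 : k + e + e * n.+1%:Z = k + e * n.+2%:Z by rewrite !intS; ring.
have E2 : k + c + d + e * n%:Z + (c - 2 * e + d) * j%:Z
          = k + e * n.+2%:Z + (c - 2 * e + d) * j.+1%:Z.
  by rewrite !intS; ring.
rewrite /term E1 E2 lucas_coefSS natrD (_ : n.+2 - 2 * j.+1 = n - 2 * j)%N; last lia.
(* If [n <= 2j], the exponent of [f] in the first term may be truncated, but its coefficient is
   zero. *)
set v := u _; case: (ltnP n.+1 j.+1.*2) => [lt_nj | le_jn].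
  by rewrite (lucas_coef_small lt_nj) !exprS; ring.
rewrite (_ : n - 2 * j = (n.+1 - 2 * j.+1).+1)%N; last lia.
by rewrite !exprS; ring.
Qed.

Let rhsSS n k : rhs n.+2 k = f * rhs n.+1 (k + e) - a * b * rhs n (k + c + d).
Proof.
(* Expanding [f * u] at these two points yields the wanted terms and two cross terms, which
   [a * b * rhs n (k + c + d)] cancels. *)
have Ec := rel_u (k + c * n.+1%:Z); have Ed := rel_u (k + d * n.+1%:Z).
rewrite /rhs.
have -> : k + c * n.+2%:Z = k + c * n.+1%:Z + c by rewrite !intS; ring.
have -> : k + d * n.+2%:Z = k + d * n.+1%:Z + d by rewrite !intS; ring.
have -> : k + e + c * n.+1%:Z = k + c * n.+1%:Z + e by ring.
have -> : k + e + d * n.+1%:Z = k + d * n.+1%:Z + e by ring.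
have -> : k + c + d + c * n%:Z = k + c * n.+1%:Z + d by rewrite !intS; ring.
have -> : k + c + d + d * n%:Z = k + d * n.+1%:Z + c by rewrite !intS; ring.
rewrite mulrDr ![f * (_ * _)]mulrCA -Ec -Ed !exprS; ring.
Qed.

(** The bound [N] is left free because the induction needs the sum for [n + 1] at the same length
    and the sum for [n] at length one less. *)
Let sum_term N n k : (n < N.*2)%N -> \sum_(0 <= j < N) term n k j = rhs n k.
Proof.
elim/ltn_ind: n N k => -[|[|n]] IH [//|N] k ltnN.
- rewrite big_nat_recl // big1_seq => [|j _]; last by rewrite term_small.
  by rewrite /term /rhs !mulr0 !addr0 !expr0 /=; ring.
- rewrite big_nat_recl // big1_seq => [|j _]; last by rewrite term_small.
  rewrite /term /rhs !mulr1 !mulr0 !addr0 !expr1 rel_u /=; ring.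
have ltn1N : (n.+1 < N.+1.*2)%N by lia.
have ltn0N : (n < N.*2)%N by lia.
rewrite rhsSS -(IH n.+1 _ _ _ ltn1N) // -(IH n _ _ _ ltn0N) //.
rewrite !(big_nat_recl N) // termS0 mulrDr -addrA; congr (_ + _).
by rewrite !mulr_sumr -sumrB; apply: eq_bigr => j _; rewrite termSS.
Qed.

Lemma lucas_sum n k :
  \sum_(0 <= j < (n %/ 2).+1)
     (-1) ^+ j * (lucas_coef n j)%:R * a ^+ j * b ^+ j * f ^+ (n - 2 * j)
     * u (k + e * n%:Z + (c - 2 * e + d) * j%:Z)
  = a ^+ n * u (k + c * n%:Z) + b ^+ n * u (k + d * n%:Z).
Proof. by apply: sum_term; lia. Qed.

End LucasSum.

(** An arbitrary initial state covers both sequences; the sum formula is applied at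
    [k = m n + p]. *)
Lemma pad_state_sum (s : int * int * int) (a b c d e f : int) :
  (a, b, c, d, e, f) \in pad_tuples ->
  forall n : nat, (0 < n)%N -> forall m p : int,
  \sum_(0 <= j < (n %/ 2).+1)
      (-1) ^+ j * (n%:R / (n - j)%N%:R) * 'C(n - j, j)%:R
      * a%:~R ^+ j * b%:~R ^+ j * f%:~R ^+ (n - 2 * j)
      * (pad_state s ((m + e) * n%:Z + p + (c - 2 * e + d) * j%:Z)).1.1%:~R
   = a%:~R ^+ n * (pad_state s ((m + c) * n%:Z + p)).1.1%:~R
     + b%:~R ^+ n * (pad_state s ((m + d) * n%:Z + p)).1.1%:~R :> rat.
Proof.
move=> abcdef n n_gt0 m p; pose u k : rat := (pad_state s k).1.1%:~R.
have rel_u k : a%:~R * u (k + c) + b%:~R * u (k + d) = f%:~R * u (k + e).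
  by rewrite /u -!intrM -intrD (pad_tuples_relation _ _ abcdef).
have shift g : (m + g) * n%:Z + p = m * n%:Z + p + g * n%:Z by ring.
rewrite !shift -/(u _) -/(u _) -(lucas_sum rel_u).
apply: eq_big_nat => j /andP[_ ltjn].
have lejn : (j.*2 <= n)%N by lia.
by rewrite lucas_coefE // !mulrA.
Qed.

Theorem theorem16 (a b c d e f : int)
  (habcdef : (a, b, c, d, e, f) \in pad_tuples)
  (n : nat) (hn : (0 < n)%N) (m p : int) :
  (\sum_(0 <= j < (n %/ 2).+1)
      (-1) ^+ j * (n%:R / (n - j)%N%:R) * 'C(n - j, j)%:R
      * a%:~R ^+ j * b%:~R ^+ j * f%:~R ^+ (n - 2 * j)
      * (padovan ((m + e) * n%:Z + p + (c - 2 * e + d) * j%:Z))%:~R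
   = a%:~R ^+ n * (padovan ((m + c) * n%:Z + p))%:~R
     + b%:~R ^+ n * (padovan ((m + d) * n%:Z + p))%:~R :> rat)
  /\
  (\sum_(0 <= j < (n %/ 2).+1)
      (-1) ^+ j * (n%:R / (n - j)%N%:R) * 'C(n - j, j)%:R
      * a%:~R ^+ j * b%:~R ^+ j * f%:~R ^+ (n - 2 * j)
      * (perrin ((m + e) * n%:Z + p + (c - 2 * e + d) * j%:Z))%:~R
   = a%:~R ^+ n * (perrin ((m + c) * n%:Z + p))%:~R
     + b%:~R ^+ n * (perrin ((m + d) * n%:Z + p))%:~R :> rat).
Proof. by split; apply: pad_state_sum. Qed.
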